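(* If $n\geq 1$ and $k\geq 1$, then the Munarini graph $M_{n,k}$ is a daisy cube. Furthermore, for $k\geq 2$, the map $\widehat{\Psi}$ is a proper embedding of $M_{n,k}$ in $Q_{kn}$, and $\Gamma_{n,k}^\star$ is the daisy cube generated by $$X=\{\widehat{\Psi}(u)\mid u\in \mathcal{A}_{n,k}\}.$$ The maximal vertices of this daisy cube are exactly the strings of $X$, that is, the images by $\widehat{\Psi}$ of the vertices of $M_{n,k}$ that contain no $0$.
   Context: For integers $k\geq 1$, $n\geq 0$, a $k$-generalized Pell string of length $n$ is a word of length $n$ over the alphabet $\{0,1,\ldots,k\}$ in which every maximal run of the character $k$ has even length; equivalently, it is a (necessarily unique) concatenation of letters from $\{0,1,\ldots,k-1,kk\}$. Let $\mathcal{F}_{n,k}$ be the set of these strings, and let $\mathcal{A}_{n,k}$ be the set of strings in $\mathcal{F}_{n,k}$ containing no character $0$. The Munarini graph $M_{n,k}$ is the simple graph with vertex set $\mathcal{F}_{n,k}$ in which two vertices are adjacent if one of them can be obtained from the other either by replacing one occurrence of $0$ with some $i\in\{1,\ldots,k-1\}$, or by replacing one substring $00$ (two consecutive positions) with $kk$ (both replacements may be read in either direction, and both strings must be in $\mathcal{F}_{n,k}$). $Q_m$ is the hypercube with vertex set $B^m=\{0,1\}^m$, two strings being adjacent iff they differ in exactly one coordinate; its graph distance is the Hamming distance. Let $A_0=0^k$ and $A_i=0^{i-1}10^{k-i}$ for $i\in\{1,\ldots,k\}$ (binary strings of length $k$). Let $\mathcal{F}_{n,k}^\star$ be the set of binary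 strings of length $kn$ that are concatenations of strings from $\{A_0,A_1,\ldots,A_{k-1},A_kA_0\}$, and let $\Gamma_{n,k}^\star$ be the subgraph of $Q_{kn}$ induced by $\mathcal{F}_{n,k}^\star$. The map $\widehat{\Psi}:\mathcal{F}_{n,k}\to\mathcal{F}_{n,k}^\star$ is obtained by writing $u\in\mathcal{F}_{n,k}$ as a concatenation of letters from $\{0,\ldots,k-1,kk\}$ and replacing each letter $i\in\{0,\ldots,k-1\}$ by $A_i$ and each letter $kk$ by $A_kA_0$. Order $B^m$ coordinatewise: $u\leq v$ iff $u_i\leq v_i$ for all $i$. For $X\subseteq B^m$, the daisy cube generated by $X$ is the subgraph $Q_m(X)$ of $Q_m$ induced by $\{u\in B^m\mid u\leq x \text{ for some } x\in X\}$. The maximal vertices of $Q_m(X)$ are the maximal elements of the poset $(X,\leq)$ (equivalently of $(V(Q_m(X)),\leq)$). A graph $G$ is a daisy cube if there is an isometric embedding of $G$ in some $Q_m$ (a map $V(G)\to B^m$ such that graph distances in $G$ equal Hamming distances of the images) and a subset $X\subseteq B^m$ such that the image of $G$ is the daisy cube $Q_m(X)$; such an embedding is called a proper embedding. *)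

(* Defs.v *)
From mathcomp Require Import all_boot.
From mathcomp Require Import zify.

Set Implicit Arguments.
Unset Strict Implicit.
Unset Printing Implicit Defensive.

(** * Finite simple graphs inside an ambient finite type *)

Record graph (T : finType) := Graph {
  verts : {set T};
  edges : {set {set T}};
  edges_wf : edges \subset [set e in powerset verts | #|e| == 2]
}.

Definition adj (T : finType) (G : graph T) : rel T :=
  fun u v => [set u; v] \in edges G.

Lemma rel_edges_wf (T : finType) (V : {set T}) (r : rel T) :
  [set [set u; v] | u in V, v in V & (u != v) && r u v]
    \subset [set e in powerset V | #|e| == 2].
Proof.
apply/subsetP => e /imset2P [u v uV]; rewrite inE => /and3P[vV uv _] ->.
by rewrite inE powersetE subUset !sub1set uV vV cards2 uv.
Qed.

(* The relation [r] is symmetrised, since edges are unordered pairs. The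
   condition u != v drops loops; it is redundant for the irreflexive relations
   used below. *)
Definition rel_graph (T : finType) (V : {set T}) (r : rel T) : graph T :=
  Graph (rel_edges_wf V r).

Lemma induced_wf (T : finType) (G : graph T) (S : {set T}) :
  edges G :&: powerset S
    \subset [set e in powerset (verts G :&: S) | #|e| == 2].
Proof.
apply/subsetP => e; rewrite !inE => /andP[eG eS].
move/subsetP: (edges_wf G) => /(_ e eG); rewrite !inE => /andP[eV ->].
by rewrite subsetI eV eS.
Qed.

Definition induced (T : finType) (G : graph T) (S : {set T}) : graph T :=
  Graph (induced_wf G S).

Definition walk (T : finType) (G : graph T) (u v : T) (p : seq T) : bool :=
  path (adj G) u p && (last u p == v).

(* [d] is the graph distance between [u] and [v]; no such [d] exists when the
   two vertices lie in different components. *)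
Definition is_dist (T : finType) (G : graph T) (u v : T) (d : nat) : Prop :=
  (exists2 p, walk G u v p & size p = d) /\
  (forall p, walk G u v p -> d <= size p).

Definition is_image (T U : finType) (f : T -> U) (G : graph T) (H : graph U) :
    Prop :=
  f @: verts G = verts H /\ [set f @: (e : {set T}) | e in edges G] = edges H.

(** * Hypercubes and daisy cubes *)

Notation bits m := (m.-tuple bool).

Definition hamming (m : nat) (u v : bits m) : nat :=
  #|[set i | tnth u i != tnth v i]|.

Definition hypercube (m : nat) : graph (bits m) :=
  rel_graph [set: bits m] (fun u v => hamming u v == 1).

Definition bits_le (m : nat) (u v : bits m) : bool :=
  [forall i, tnth u i <= tnth v i].

Definition down (m : nat) (X : {set bits m}) : {set bits m} :=
  [set u | [exists x in X, bits_le u x]].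

Definition daisy_cube (m : nat) (X : {set bits m}) : graph (bits m) :=
  induced (hypercube m) (down X).

Definition maximal_elements (m : nat) (S : {set bits m}) : {set bits m} :=
  [set x in S | [forall y in S, bits_le x y ==> (y == x)]].

Definition maximal_vertices (m : nat) (G : graph (bits m)) : {set bits m} :=
  maximal_elements (verts G).

Definition isometric (T : finType) (m : nat) (G : graph T) (f : T -> bits m) :
    Prop :=
  {in verts G &, forall u v, is_dist G u v (hamming (f u) (f v))}.

(* Only the values of [f] on the vertices of [G] matter. *)
Definition proper_embedding (T : finType) (m : nat) (G : graph T)
    (f : T -> bits m) : Prop :=
  isometric G f /\ exists X : {set bits m}, is_image f G (daisy_cube X).

Definition is_daisy_cube (T : finType) (G : graph T) : Prop :=
  exists (m : nat) (f : T -> bits m), proper_embedding G f.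

(** * Generalized Pell strings and Munarini graphs *)

(* In ['I_k.+1] the character k is [ord_max]. *)
Notation word n k := (n.-tuple 'I_k.+1).

(* The positions a, ..., b - 1 form a maximal run of the character c. *)
Definition maximal_run (n k : nat) (u : word n k) (c : 'I_k.+1) (a b : nat) :
    bool :=
  [&& a < b <= n,
      [forall i : 'I_n, (a <= i < b) ==> (tnth u i == c)]
    & [forall i : 'I_n, (i.+1 == a) || (i == b :> nat) ==> (tnth u i != c)]].

Definition pell_strings (n k : nat) : {set word n k} :=
  [set u | [forall a : 'I_n.+1, forall b : 'I_n.+1,
              maximal_run u ord_max a b ==> ~~ odd (b - a)]].

Definition zerofree_pell_strings (n k : nat) : {set word n k} :=
  [set u in pell_strings n k | ord0 \notin u].

(* [v] is obtained from [u] by replacing one 0 with some i in {1, ..., k-1}. *)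
Definition step1 (n k : nat) (u v : word n k) : bool :=
  [exists j : 'I_n,
     [&& tnth u j == ord0, 0 < tnth v j < k
       & [forall i : 'I_n, (i != j) ==> (tnth v i == tnth u i)]]].

(* [v] is obtained from [u] by replacing one substring 00 with kk. *)
Definition step2 (n k : nat) (u v : word n k) : bool :=
  [exists j : 'I_n, exists j' : 'I_n,
     [&& j' == j.+1 :> nat,
         (tnth u j == ord0) && (tnth u j' == ord0),
         (tnth v j == ord_max) && (tnth v j' == ord_max)
       & [forall i : 'I_n,
            (i != j) && (i != j') ==> (tnth v i == tnth u i)]]].

Definition munarini (n k : nat) : graph (word n k) :=
  rel_graph (pell_strings n k) (fun u v => step1 u v || step2 u v).

(** * The binary encoding *)

(* The letters 0, ..., k-1 are [Some i], and the letter kk is [None]. *)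
Notation letter k := (option 'I_k).

Definition letter_word (k : nat) (l : letter k) : seq 'I_k.+1 :=
  if l is Some i then [:: widen_ord (leqnSn k) i] else [:: ord_max; ord_max].

Definition expand (k : nat) (s : seq (letter k)) : seq 'I_k.+1 :=
  flatten [seq letter_word l | l <- s].

(* The strings A_0 = 0^k and A_i = 0^(i-1) 1 0^(k-i). *)
Definition block (k i : nat) : seq bool :=
  if i is j.+1 then nseq j false ++ true :: nseq (k - i) false
  else nseq k false.

Definition letter_code (k : nat) (l : letter k) : seq bool :=
  if l is Some i then block k i else block k k ++ block k 0.

Definition encode (k : nat) (s : seq (letter k)) : seq bool :=
  flatten [seq letter_code l | l <- s].

(* The decomposition of a Pell string into letters; see [parseK] and
   [pell_stringsP]. The value on other words is irrelevant. *)
Fixpoint parse (k : nat) (u : seq 'I_k.+1) : seq (letter k) :=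
  match u with
  | [::] => [::]
  | c :: u' =>
      if insub (val c) is Some i then Some i :: parse u'
      else None :: (if u' is _ :: u'' then parse u'' else [::])
  end.

(* On Pell strings no padding or truncation takes place; see [PsiE]. *)
Definition Psi (n k : nat) (u : word n k) : bits (k * n) :=
  [tuple nth false (encode (parse u)) i | i < k * n].

(* Concatenations of codes of total length k n; there are at most n of them
   when k > 0, as each code has length at least k; see [FstarP]. *)
Definition Fstar (n k : nat) : {set bits (k * n)} :=
  [set w : bits (k * n) | [exists p : 'I_n.+1, exists s : p.-tuple (letter k),
              encode s == w]].

Definition Gamma_star (n k : nat) : graph (bits (k * n)) :=
  induced (hypercube (k * n)) (Fstar n k).

(** * Consistency of the definitions *)

Lemma bits_le_refl (m : nat) (u : bits m) : bits_le u u.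
Proof. by apply/forallP. Qed.

Lemma bits_le_trans (m : nat) (v u w : bits m) : bits_le u v -> bits_le v w -> bits_le u w.
Proof.
move=> /forallP uv /forallP vw; apply/forallP => i.
exact: leq_trans (uv i) (vw i).
Qed.

Lemma bits_le_anti (m : nat) (u v : bits m) : bits_le u v -> bits_le v u -> u = v.
Proof.
move=> /forallP uv /forallP vu; apply: eq_from_tnth => i.
by have := uv i; have := vu i; case: (tnth u i); case: (tnth v i).
Qed.

Lemma maximal_vertices_daisy (m : nat) (X : {set bits m}) :
  maximal_vertices (daisy_cube X) = maximal_elements X.
Proof.
rewrite /maximal_vertices /= setTI; apply/setP => x; rewrite !inE.
apply/andP/andP => -[].
- case/existsP => y /andP[yX xy] /forallP mx.
  have yD : y \in down X by rewrite inE; apply/existsP; exists y; rewrite yX bits_le_refl.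
  have /eqP yx := implyP (implyP (mx y) yD) xy; split; first by rewrite -yx.
  apply/forallP => z; apply/implyP => zX; apply: (implyP (mx z)).
  by rewrite inE; apply/existsP; exists z; rewrite zX bits_le_refl.
- move=> xX /forallP mx; split; first by apply/existsP; exists x; rewrite xX bits_le_refl.
  apply/forallP => z; apply/implyP; rewrite inE => /existsP[y /andP[yX zy]].
  apply/implyP => xz; have xy := bits_le_trans xz zy.
  have /eqP yx := implyP (implyP (mx y) yX) xy.
  by apply/eqP/bits_le_anti; rewrite // -yx.
Qed.

Lemma parse_cat (k : nat) (l : letter k) (u : seq 'I_k.+1) :
  parse (letter_word l ++ u) = l :: parse u.
Proof.
case: l => [i|] /=; first by rewrite (insubT (fun j => j < k) (ltn_ord i)) /=;
  congr (Some _ :: _); apply: val_inj.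
by rewrite insubF //= ltnn.
Qed.

Lemma parseK (k : nat) : cancel (@expand k) (@parse k).
Proof. by elim=> [|l s IH] //; rewrite /expand /= parse_cat IH. Qed.

Lemma size_block (k i : nat) : i <= k -> size (block k i) = k.
Proof.
by case: i => [|i] ik; rewrite /block ?size_cat /= !size_nseq; lia.
Qed.

Lemma size_encode (k : nat) (s : seq (letter k)) :
  size (encode s) = k * size (expand s).
Proof.
elim: s => [|l s IH]; first by rewrite muln0.
rewrite /encode /expand /= !size_cat -/(encode s) -/(expand s) IH.
rewrite mulnDr; congr (_ + _); case: l => [i|] /=.
  by rewrite size_block ?muln1 // ltnW.
by rewrite size_cat size_block // size_nseq muln2 addnn.
Qed.

Definition even_runs (T : eqType) (x0 c : T) (u : seq T) : Prop :=
  forall a b, a < b -> b <= size u ->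
    (forall i, a <= i < b -> nth x0 u i = c) ->
    (forall i, i < size u -> (i.+1 == a) || (i == b) -> nth x0 u i != c) ->
    ~~ odd (b - a).

Lemma pell_even_runs (n k : nat) (u : word n k) :
  u \in pell_strings n k <-> even_runs ord0 ord_max u.
Proof.
rewrite inE; split.
- move=> /forallP H a b ab; rewrite size_tuple => bn H1 H2.
  have an : a < n.+1 by lia.
  have /forallP /(_ (Ordinal (bn : b < n.+1))) /implyP := H (Ordinal an).
  apply; apply/and3P; split; first by rewrite /= ab.
  + by apply/forallP => i; apply/implyP => /= hi; rewrite (tnth_nth ord0) H1.
  + apply/forallP => i; apply/implyP => /= hi; rewrite (tnth_nth ord0).
    by apply: H2.
- move=> H; apply/forallP => a; apply/forallP => b; apply/implyP.
  case/and3P => /andP[ab bn] /forallP H1 /forallP H2.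
  apply: H; rewrite ?size_tuple //.
  + move=> i hi; have iN : i < n by lia.
    by have /implyP /(_ hi) /eqP := H1 (Ordinal iN); rewrite (tnth_nth ord0).
  + move=> i iN hi.
    by have /implyP /(_ hi) := H2 (Ordinal iN); rewrite (tnth_nth ord0).
Qed.

Lemma even_runs_expand (k : nat) (s : seq (letter k)) :
  even_runs ord0 ord_max (expand s).
Proof.
elim: s => [|l s IH] a b ab; first by rewrite /=; lia.
rewrite /expand /= -/(expand s); case: l => [i|] /= bs H1 H2.
- case: a b ab bs H1 H2 => [|a] [|b] // ab bs H1 H2.
    have /(congr1 val) /= : widen_ord (leqnSn k) i = ord_max by apply: (H1 0).
    by have := ltn_ord i; lia.
  by rewrite subSS; apply: IH => // j hj; [apply: (H1 j.+1)|apply: (H2 j.+1)].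
- case: a ab H1 H2 => [|[|a]] ab H1 H2.
  + case: b ab bs H1 H2 => [|[|[|b]]] // _ bs H1 H2; first by have := H2 1 isT isT; rewrite eqxx.
    have -> : odd (b.+3 - 0) = odd (b.+1 - 0) by rewrite !subn0 /= negbK.
    apply: IH => // j hj.
      exact: (H1 j.+2).
    by move=> /orP[//|e]; apply: (H2 j.+2).
  + by have := H2 0 isT isT; rewrite eqxx.
  + case: b ab bs H1 H2 => [|[|b]] // ab bs H1 H2.
    rewrite !subSS; case: a ab H1 H2 => [|a] ab H1 H2.
      by have := H2 1 isT isT; rewrite eqxx.
    by apply: IH => // j hj; [apply: (H1 j.+2)|apply: (H2 j.+2)].
Qed.

Lemma even_runs_parse (k : nat) (u : seq 'I_k.+1) :
  even_runs ord0 ord_max u -> exists s, u = expand s.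
Proof.
have [N] := ubnP (size u); elim: N u => // N IH [|x u] /= uN H.
  by exists [::].
have [xk|xk] := eqVneq x ord_max.
- subst x; case: u uN H => [|y u] /= uN H.
    suff : ~~ odd (1 - 0) by [].
    by apply: H => //; case.
  have [yk|yk] := eqVneq y ord_max; last first.
    suff : ~~ odd (1 - 0) by [].
    by apply: H => //; [case|case=> [|[]]].
  subst y; case: (IH u) => [|a b ab bs H1 H2|s ->]; first by lia.
    case: a ab H1 H2 => [|a] ab H1 H2.
      have -> : odd (b - 0) = odd (b.+2 - 0) by rewrite !subn0 /= negbK.
      apply: H => //.
        by move=> [|[|j]] hj //=; apply: H1; lia.
      by move=> [|[|j]] hj //= e; apply: H2 => //; move: e; lia.
    rewrite -subSS -[b.+1 - _]subSS; apply: H => //.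
      by move=> [|[|j]] hj //=; apply: H1; lia.
    by move=> [|[|j]] hj //= e; apply: H2 => //; move: e; lia.
  by exists (None :: s).
- case: (IH u) => [|a b ab bs H1 H2|s ->]; first by lia.
    rewrite -subSS; apply: H => //.
      by move=> [|j] hj //=; apply: H1; lia.
    by move=> [|j] hj //= e; apply: H2 => //; move: e; lia.
  have xlt : x < k.
    by have := ltn_ord x; rewrite ltnS leq_eqVlt => /orP[/eqP e|//];
       case/eqP: xk; apply: val_inj.
  exists (Some (Ordinal xlt) :: s); rewrite /expand /=; congr (_ :: _).
  exact: val_inj.
Qed.

Lemma pell_stringsP (n k : nat) (u : word n k) :
  u \in pell_strings n k <-> exists s : seq (letter k), u = expand s :> seq _.
Proof.
rewrite pell_even_runs; split; first exact: even_runs_parse.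
by case=> s ->; apply: even_runs_expand.
Qed.

Lemma PsiE (n k : nat) (u : word n k) :
  u \in pell_strings n k -> Psi u = encode (parse u) :> seq bool.
Proof.
case/pell_stringsP => s us.
have sz : size (encode (parse u)) = k * n.
  by rewrite us parseK size_encode -us size_tuple.
apply: (@eq_from_nth _ false); first by rewrite size_tuple sz.
move=> i; rewrite size_tuple => ikn.
by rewrite -[i]/(val (Ordinal ikn)) -tnth_nth tnth_mktuple.
Qed.

Lemma FstarP (n k : nat) (w : bits (k * n)) : 0 < k ->
  w \in Fstar n k <-> exists s : seq (letter k), w = encode s :> seq bool.
Proof.
move=> k0; rewrite inE; split.
  by case/existsP => p /existsP[s /eqP <-]; exists s.
case=> s ws; have : size (encode s) = k * n by rewrite -ws size_tuple.
rewrite size_encode => /eqP; rewrite eqn_pmul2l // => /eqP sn.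
have szs : size s < n.+1.
  rewrite ltnS -sn; elim: s {ws sn} => [|l s IH] //.
  by rewrite /expand /= size_cat -/(expand s); case: l => [i|] /=; lia.
by apply/existsP; exists (Ordinal szs); apply/existsP; exists (in_tuple s); rewrite ws.
Qed.

Lemma Psi_Fstar (n k : nat) (u : word n k) : 0 < k ->
  u \in pell_strings n k -> Psi u \in Fstar n k.
Proof. by move=> k0 uF; apply/FstarP => //; exists (parse u); apply: PsiE. Qed.

(* Main.v *)
(* The set of codes of Pell strings is downward closed in the hypercube:
   clearing a bit turns a block A_i into A_0, or A_k A_0 into A_0 A_0.  In a
   downward closed set any two strings are joined by a geodesic that first clears
   and then raises bits, so the induced subgraph is isometric.  On the level of
   letters, raising one bit of a code is exactly one step 0 -> i or 00 -> kk, so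
   Psi carries the Munarini graph onto this induced subgraph.  For k >= 2 every 0
   can be raised to 1, and the code of a zero-free string is maximal because each
   of its blocks, read from the left, determines the corresponding letter. *)

Require Import Defs.
From mathcomp Require Import all_boot.
From mathcomp Require Import zify.

Set Implicit Arguments.
Unset Strict Implicit.
Unset Printing Implicit Defensive.

(** * Adjacency, edges and images of graphs *)

Lemma adj_rel_graph (T : finType) (V : {set T}) (r : rel T) (u v : T) :
  adj (rel_graph V r) u v = [&& u \in V, v \in V, u != v & r u v || r v u].
Proof.
rewrite /adj /=; apply/imset2P/and4P => [[x y xV]|[uV vV uv /orP[ruv|rvu]]].
- rewrite inE => /and3P[yV xy rxy] e.
  have /set2P ux : u \in [set x; y] by rewrite -e set21.
  have /set2P vx : v \in [set x; y] by rewrite -e set22.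
  have /set2P xu : x \in [set u; v] by rewrite e set21.
  have /set2P yu : y \in [set u; v] by rewrite e set22.
  case: ux => ?; subst u; case: vx => ?; subst v.
  + by case: yu => yx; rewrite yx eqxx in xy.
  + by rewrite xV yV xy rxy.
  + by rewrite xV yV eq_sym xy rxy orbT.
  + by case: xu => yx; rewrite yx eqxx in xy.
- by exists u v => //; rewrite inE vV uv.
- by exists v u => //; rewrite ?inE 1?setUC // uV eq_sym uv.
Qed.

Lemma adj_induced (T : finType) (G : graph T) (S : {set T}) (u v : T) :
  adj (induced G S) u v = [&& adj G u v, u \in S & v \in S].
Proof. by rewrite /adj /= inE powersetE subUset !sub1set. Qed.

Lemma adj_verts (T : finType) (G : graph T) (u v : T) :
  adj G u v -> u \in verts G /\ v \in verts G.
Proof.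
move/(subsetP (edges_wf G)); rewrite inE powersetE subUset !sub1set.
by case/andP => /andP[].
Qed.

Lemma edgesP (T : finType) (G : graph T) (e : {set T}) :
  e \in edges G -> exists u v, [/\ u \in verts G, v \in verts G & e = [set u; v]].
Proof.
move=> eG; have := subsetP (edges_wf G) e eG; rewrite inE => /andP[_].
case/cards2P => u [v [uv e2]]; exists u, v.
by have [] : u \in verts G /\ v \in verts G by apply: adj_verts; rewrite /adj -e2.
Qed.

(** Edges are unordered pairs of vertices, so adjacency determines the edge set. An edge of [H]
    lifts to [G] because both its ends are images of vertices. *)
Lemma is_image_adj (T U : finType) (f : T -> U) (G : graph T) (H : graph U) :
  f @: verts G = verts H ->
  {in verts G &, forall u v, adj G u v = adj H (f u) (f v)} ->
  is_image f G H.
Proof.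
move=> fV fA; split=> //; apply/setP => e; apply/imsetP/idP.
- case=> e' e'G ->; have [u [v [uV vV e2]]] := edgesP e'G.
  by rewrite e2 imsetU1 imset_set1 -/(adj H (f u) (f v)) -fA // /adj -e2.
- move=> eH; have [x [y []]] := edgesP eH.
  rewrite -fV => /imsetP[u uV ->] /imsetP[v vV ->] e2.
  exists [set u; v]; last by rewrite imsetU1 imset_set1.
  by rewrite -/(adj G u v) fA // /adj -e2.
Qed.

(** * Hamming distance and geodesics in downward closed sets *)

Lemma hammingC (m : nat) (u v : bits m) : hamming u v = hamming v u.
Proof. by apply: eq_card => i; rewrite !inE eq_sym. Qed.

Lemma hamming0 (m : nat) (u v : bits m) : (hamming u v == 0) = (u == v).
Proof.
rewrite cards_eq0; apply/eqP/eqP => [e|->]; last first.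
  by apply/setP => i; rewrite !inE eqxx.
apply: eq_from_tnth => i; have := in_set0 i.
by rewrite -e inE => /negbFE/eqP.
Qed.

Lemma hamming_triangle (m : nat) (v u w : bits m) :
  hamming u w <= hamming u v + hamming v w.
Proof.
rewrite -cardsUI; apply: leq_trans (leq_addr _ _); apply: subset_leq_card.
apply/subsetP => i; rewrite !inE.
by case: (tnth u i); case: (tnth v i); case: (tnth w i).
Qed.

Definition flip (m : nat) (u : bits m) (i : 'I_m) : bits m :=
  [tuple (j == i) (+) tnth u j | j < m].

Lemma tnth_flip (m : nat) (u : bits m) (i j : 'I_m) :
  tnth (flip u i) j = (j == i) (+) tnth u j.
Proof. by rewrite tnth_mktuple. Qed.

Lemma hamming_flip (m : nat) (u : bits m) (i : 'I_m) : hamming u (flip u i) = 1.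
Proof.
rewrite -(cards1 i); apply: eq_card => j; rewrite !inE tnth_flip.
by case: (j == i); case: (tnth u j).
Qed.

Lemma hamming_flipl (m : nat) (u v : bits m) (i : 'I_m) :
  tnth u i != tnth v i -> hamming u v = (hamming (flip u i) v).+1.
Proof.
move=> uvi; rewrite {1}/hamming (cardsD1 i) inE uvi; congr _.+1.
apply: eq_card => j; rewrite !inE tnth_flip.
by have [->|] := eqVneq j i => //; move: uvi; case: (tnth u i); case: (tnth v i).
Qed.

(* A bit set in [u] but not in [v] is cleared first; when there is none,
   [u <= v] and raising a bit keeps the string below [v]. *)
Lemma down_step (m : nat) (X : {set bits m}) (u v : bits m) :
  u \in down X -> v \in down X -> u != v ->
  exists w, [/\ w \in down X, hamming u w = 1 & hamming u v = (hamming w v).+1].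
Proof.
move=> uX vX uv.
have [i uvi wX] : exists2 i, tnth u i != tnth v i & flip u i \in down X.
  have [/existsP[i /andP[ui vi]]|] := boolP [exists i, tnth u i && ~~ tnth v i].
    exists i; first by rewrite ui; case: (tnth v i) vi.
    move: uX; rewrite !inE => /existsP[x /andP[xX ux]]; apply/existsP; exists x.
    rewrite xX; apply/forallP => j; rewrite tnth_flip.
    by have [->|_] := eqVneq j i; rewrite ?ui // (forallP ux).
  rewrite negb_exists => /forallP ule.
  have : hamming u v != 0 by rewrite hamming0.
  rewrite cards_eq0 => /set0Pn[i]; rewrite inE => uvi; exists i => //.
  move: vX; rewrite !inE => /existsP[x /andP[xX vx]]; apply/existsP; exists x.
  rewrite xX; apply: bits_le_trans vx; apply/forallP => j; rewrite tnth_flip.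
  have [->|_] := eqVneq j i; last by have := ule j; case: (tnth u j); case: (tnth v j).
  by have := ule i; move: uvi; case: (tnth u i); case: (tnth v i).
by exists (flip u i); rewrite hamming_flip -hamming_flipl.
Qed.

Lemma adj_daisy_cube (m : nat) (X : {set bits m}) (u v : bits m) :
  adj (daisy_cube X) u v = [&& hamming u v == 1, u \in down X & v \in down X].
Proof.
rewrite adj_induced adj_rel_graph !in_setT /= [hamming v u]hammingC orbb.
by rewrite -hamming0; case: eqP => [->|] //=; rewrite andbF.
Qed.

(** Each edge of a walk costs Hamming distance 1, so the triangle inequality bounds the length of a
    walk from below. A walk attaining the bound comes from iterating [down_step], whose intermediate
    strings are pulled back through the surjection onto [down X]. *)
Lemma proper_embedding_adj (T : finType) (m : nat) (G : graph T)
    (f : T -> bits m) (X : {set bits m}) :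
  {in verts G &, injective f} -> f @: verts G = down X ->
  {in verts G &, forall u v, adj G u v = (hamming (f u) (f v) == 1)} ->
  proper_embedding G f.
Proof.
move=> fI fV fA; have fX u : u \in verts G -> f u \in down X.
  by rewrite -fV; apply: imset_f.
split; last first.
  exists X; apply: is_image_adj => [|u v uV vV]; first by rewrite fV /= setTI.
  by rewrite adj_daisy_cube !fX // fA // !andbT.
move=> u v uV vV; split; last first.
  move=> p; elim: p u {uV} => [|x p IH] u; rewrite /walk /=.
    by move/eqP->; rewrite leqn0 hamming0.
  case/andP => /andP[ux xp] lp; have [uV xV] := adj_verts ux.
  apply: leq_trans (hamming_triangle (f x) _ _) _.
  move: ux; rewrite fA // => /eqP ->; rewrite add1n ltnS; apply: IH.
  by rewrite /walk xp.
move eqd: (hamming (f u) (f v)) => d; elim: d u uV eqd => [|d IH] u uV eqd.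
  exists [::] => //; rewrite /walk /=; apply/eqP/fI => //.
  by apply/eqP; rewrite -hamming0 eqd.
have fuv : f u != f v by rewrite -hamming0 eqd.
have [w [wX uw]] := down_step (fX u uV) (fX v vV) fuv.
rewrite eqd => -[dw]; move: wX uw dw; rewrite -fV => /imsetP[x xV ->] uw dw.
have [p /andP[xp lp] sp] := IH x xV (esym dw).
by exists (x :: p); rewrite /walk /= ?sp // fA // uw eqxx xp.
Qed.

(** Of two strings differing in a single coordinate, the one with a 0 there is the smaller. This
    orients the edges of the hypercube, to match the directed steps 0 -> i and 00 -> kk. *)
Lemma hamming1_le (m : nat) (u v : bits m) :
  hamming u v = 1 -> bits_le u v || bits_le v u.
Proof.
case/eqP/cards1P => i /setP uvi.
have uvE j : j != i -> tnth u j = tnth v j.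
  by have := uvi j; rewrite !inE => <- /negPn/eqP.
case ui: (tnth u i); apply/orP; [right|left]; apply/forallP => j;
  by have [->|/uvE->] := eqVneq j i; rewrite ?ui //; case: (tnth v i).
Qed.

(** * Order and Hamming distance on bit sequences *)

(** Bare sequences replace tuples so that comparisons split along concatenated blocks. As [all2]
    fails on different lengths, comparable sequences have equal length. *)
Definition seq_le (a b : seq bool) : bool := all2 implb a b.

(** Since [zip] truncates to the shorter sequence, this is the Hamming distance only for equal
    lengths. *)
Definition seq_hamming (a b : seq bool) : nat :=
  count (fun p => p.1 != p.2) (zip a b).

Lemma seq_le_cat (a1 a2 b1 b2 : seq bool) : size a1 = size b1 ->
  seq_le (a1 ++ a2) (b1 ++ b2) = seq_le a1 b1 && seq_le a2 b2.
Proof.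
by rewrite /seq_le; elim: a1 b1 => [|x a IH] [|y b] //= [/IH ->]; rewrite andbA.
Qed.

Lemma seq_hamming_cat (a1 a2 b1 b2 : seq bool) : size a1 = size b1 ->
  seq_hamming (a1 ++ a2) (b1 ++ b2) = seq_hamming a1 b1 + seq_hamming a2 b2.
Proof. by move=> e; rewrite /seq_hamming zip_cat // count_cat. Qed.

Lemma seq_leP (a b : seq bool) :
  reflect (size a = size b /\ forall i, nth false a i -> nth false b i)
          (seq_le a b).
Proof.
rewrite /seq_le; apply: (iffP idP).
- elim: a b => [|x a IH] [|y b] //= /andP[xy /IH[-> ab]]; split=> // -[|i] /=.
    by move/implyP: xy.
  exact: ab.
- elim: a b => [|x a IH] [|y b] [] //= [sab] ab; apply/andP; split.
    exact/implyP/(ab 0).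
  by apply: IH; split=> // i; apply: (ab i.+1).
Qed.

Lemma seq_hammingxx (a : seq bool) : seq_hamming a a = 0.
Proof. by rewrite /seq_hamming; elim: a => //= x a ->; rewrite eqxx. Qed.

Lemma seq_hamming_eq0 (a b : seq bool) :
  size a = size b -> seq_hamming a b = 0 -> a = b.
Proof.
rewrite /seq_hamming; elim: a b => [|x a IH] [|y b] //= [sab].
by case: eqP => //= -> /(IH _ sab) ->.
Qed.

Lemma hamming_seq (m : nat) (u v : bits m) : hamming u v = seq_hamming u v.
Proof.
have uvE : zip u v = [seq (tnth u i, tnth v i) | i <- enum 'I_m].
  by rewrite -[in LHS](map_tnth_enum u) -[in LHS](map_tnth_enum v) zip_map.
rewrite /seq_hamming uvE count_map -size_filter /hamming cardsE cardE.
by rewrite /enum_mem filter_predT.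
Qed.

Lemma bits_le_seq (m : nat) (u v : bits m) : bits_le u v = seq_le u v.
Proof.
apply/forallP/seq_leP => [uv|[_ uv] i].
  rewrite !size_tuple; split=> // i; have [im|im] := ltnP i m; last first.
    by rewrite nth_default // size_tuple.
  by have := uv (Ordinal im); rewrite !(tnth_nth false) /=; do 2?case: nth.
by have := uv i; rewrite !(tnth_nth false) /=; do 2?case: nth => //; move/(_ isT).
Qed.

(** * The blocks A_i *)

(** The only 1 of A_i with i > 0 sits at index i - 1. For i = 0 the test fails for every [p], so one
    formula covers A_0 as well. *)
Lemma nth_block (k i p : nat) : i <= k -> nth false (block k i) p = (p.+1 == i).
Proof.
case: i => [|i] ik; rewrite /block; first by rewrite nth_nseq if_same.
rewrite nth_cat size_nseq nth_nseq if_same eqSS; case: ltngtP => // [ip|->].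
  by case: (p - i) (subn_gt0 i p) => [|q]; rewrite ip //= nth_nseq if_same.
by rewrite subnn.
Qed.

Lemma seq_le_block (k i j : nat) : i <= k -> j <= k ->
  seq_le (block k i) (block k j) = (i == 0) || (i == j).
Proof.
move=> ik jk; apply/seq_leP/orP; rewrite !size_block //.
- case: i ik => [|i] ik [_ H]; first by left.
  by right; have := H i; rewrite !nth_block // eqxx; apply.
- move=> ij; split=> // p; rewrite !nth_block // => /eqP pi.
  by move: ij; rewrite -pi => -[].
Qed.

Lemma seq_hamming_block (k i j : nat) : i <= k -> j <= k ->
  seq_le (block k i) (block k j) ->
  seq_hamming (block k i) (block k j) = (i != j).
Proof.
move=> ik jk; rewrite seq_le_block //.
have [->|ij] /= := eqVneq i j; first by rewrite seq_hammingxx.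
rewrite orbF => /eqP i0; case: j jk ij => [|j] jk; first by rewrite i0.
move=> _; rewrite i0 /block.
(* Splitting the zero block at index [j] aligns it with [block k j.+1], whose 1 is at that index. *)
rewrite (_ : nseq k false = nseq j false ++ false :: nseq (k - j.+1) false).
  rewrite seq_hamming_cat // seq_hammingxx.
  by rewrite /seq_hamming /= -/(seq_hamming _ _) seq_hammingxx.
by rewrite -[false :: _]/(nseq (k - j.+1).+1 false) -nseqD; congr nseq; lia.
Qed.

Lemma seq_le_blockP (k i : nat) (w : seq bool) : i <= k ->
  seq_le w (block k i) -> w = block k 0 \/ w = block k i.
Proof.
move=> ik /seq_leP[sw le_w]; rewrite size_block // in sw.
have eq_w j : j <= k ->
    (forall p, nth false w p = (p.+1 == j)) -> w = block k j.
  move=> jk wp; apply: (@eq_from_nth _ false); first by rewrite sw size_block.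
  by move=> p _; rewrite wp nth_block.
(* Only the bit at [i.-1] can be set in [w]. The conjunct [0 < i] excludes the block A_0, for which
   [i.-1] is 0 as well. *)
case wi: (nth false w i.-1 && (0 < i)).
- right; apply: eq_w => // p; apply/idP/eqP.
    by move/le_w; rewrite nth_block // => /eqP.
  by move=> pi; move: wi; rewrite -pi andbT.
- left; apply: eq_w => // p; apply/negbTE/negP => wp.
  by have := le_w _ wp; rewrite nth_block // => /eqP pi; move: wi; rewrite -pi wp.
Qed.

Lemma seq_le_block_cat (k j : nat) (w b : seq bool) : j <= k ->
  seq_le w (block k j ++ b) ->
  exists2 w', w = block k 0 ++ w' \/ w = block k j ++ w' & seq_le w' b.
Proof.
move=> jk le_w; have sw : size (take k w) = size (block k j).
  have [sw _] := seq_leP _ _ le_w.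
  by rewrite size_takel ?sw ?size_cat size_block // leq_addr.
move: le_w; rewrite -{1}(cat_take_drop k w) seq_le_cat // => /andP[le_w ?].
exists (drop k w) => //; rewrite -{1 3}(cat_take_drop k w).
by case: (seq_le_blockP jk le_w) => ->; [left|right].
Qed.

(** * Comparing codes letter by letter *)

Lemma encode_some (k : nat) (i : 'I_k) (s : seq (letter k)) :
  encode (Some i :: s) = block k i ++ encode s.
Proof. by []. Qed.

(** The nesting to the right lets A_k and A_0 be peeled off as two separate blocks. *)
Lemma encode_none (k : nat) (s : seq (letter k)) :
  encode (None :: s) = block k k ++ (block k 0 ++ encode s).
Proof. by rewrite /encode /= catA. Qed.

(** The smaller string is decoded from the left: only A_0 and A_i lie below A_i, and only A_0 A_0
    and A_k A_0 lie below A_k A_0. *)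
Lemma encode_downward (k : nat) (s : seq (letter k)) (w : seq bool) : 0 < k ->
  seq_le w (encode s) -> exists t : seq (letter k), w = encode t.
Proof.
move=> k0; elim: s w => [|l s IH] w.
  by case: w => // _; exists [::].
pose z : letter k := Some (Ordinal k0).
case: l => [i|]; rewrite ?encode_none ?encode_some.
- case/seq_le_block_cat => [|w' we /IH[t w'E]]; first exact: ltnW.
  by case: we => ->; [exists (z :: t)|exists (Some i :: t)]; rewrite w'E.
- case/seq_le_block_cat => // w1 we /seq_le_block_cat[] // w2 w1E /IH[t w2E].
  (* Both alternatives for the second block are A_0. *)
  have {}w1E : w1 = block k 0 ++ encode t by case: w1E => ->; rewrite w2E.
  by case: we => ->; [exists [:: z, z & t]|exists (None :: t)];
    rewrite ?encode_none w1E.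
Qed.

Lemma size_expand_cons (k : nat) (l : letter k) (s : seq (letter k)) :
  size (expand (l :: s)) = size (expand s) + (if l is Some _ then 1 else 2).
Proof. by rewrite addnC /expand /= size_cat; case: l. Qed.

(** Comparable codes have equal length, and for k > 0 every letter has a nonempty code. *)
Lemma seq_le_encode_nil (k : nat) (s t : seq (letter k)) : 0 < k ->
  seq_le (encode s) (encode t) -> (s == [::]) = (t == [::]).
Proof.
move=> k0 /seq_leP[/eqP + _]; rewrite !size_encode eqn_pmul2l // => /eqP.
case: s t => [|l s] [|l' t] //; rewrite size_expand_cons addnC.
  by case: l'.
by case: l.
Qed.

Lemma seq_le_encode_some (k : nat) (i j : 'I_k) (s t : seq (letter k)) :
  seq_le (encode (Some i :: s)) (encode (Some j :: t)) =
  ((i == 0 :> nat) || (i == j)) && seq_le (encode s) (encode t).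
Proof.
have [ik jk] := (ltnW (ltn_ord i), ltnW (ltn_ord j)).
by rewrite !encode_some seq_le_cat ?size_block // seq_le_block.
Qed.

Lemma seq_le_encode_none (k : nat) (s t : seq (letter k)) :
  seq_le (encode (None :: s)) (encode (None :: t)) = seq_le (encode s) (encode t).
Proof.
by rewrite !encode_none !seq_le_cat ?size_block // !seq_le_block // eqxx orbT.
Qed.

(** As i < k, the block A_i lies below A_k only if i = 0. The trailing A_0 of the code of kk is then
    left over and is read as the code of the letter 0, for which [Some i] itself serves. *)
Lemma seq_le_encode_some_none (k : nat) (i : 'I_k) (s t : seq (letter k)) :
  seq_le (encode (Some i :: s)) (encode (None :: t)) =
  (i == 0 :> nat) && seq_le (encode s) (encode (Some i :: t)).
Proof.
have ik := ltnW (ltn_ord i).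
rewrite encode_none encode_some seq_le_cat ?size_block // seq_le_block //.
rewrite (ltn_eqF (ltn_ord i)) orbF encode_some.
by case: eqP => //= ->.
Qed.

Lemma seq_le_encode_none_some (k : nat) (j : 'I_k) (s t : seq (letter k)) :
  seq_le (encode (None :: s)) (encode (Some j :: t)) = false.
Proof.
have jk := ltn_ord j; have jk' := ltnW jk.
rewrite encode_none encode_some seq_le_cat ?size_block // seq_le_block //.
by rewrite (gtn_eqF jk) (gtn_eqF (leq_ltn_trans (leq0n j) jk)).
Qed.

Lemma seq_le_refl (a : seq bool) : seq_le a a.
Proof. exact/seq_leP. Qed.

Definition zerofree (k : nat) (s : seq (letter k)) : bool :=
  all (fun l : letter k => if l is Some i then 0 < i else true) s.

(** A block with a 1 lies below no other block, so the first letters agree and the induction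
    proceeds on the tails. *)
Lemma zerofree_maximal (k : nat) (s t : seq (letter k)) : 0 < k ->
  zerofree s -> seq_le (encode s) (encode t) -> s = t.
Proof.
move=> k0; elim: s t => [|l s IH] [|l' t] // => [_|_|].
- by move/(seq_le_encode_nil k0).
- by move/(seq_le_encode_nil k0).
case: l l' => [i|] [j|] /andP[l0 /IH sz].
- by rewrite seq_le_encode_some (gtn_eqF l0) => /andP[/eqP -> /sz ->].
- by rewrite seq_le_encode_some_none (gtn_eqF l0).
- by rewrite seq_le_encode_none_some.
- by rewrite seq_le_encode_none => /sz ->.
Qed.

(** Equal codes are comparable in both directions, so the comparison lemmas for first letters apply
    twice: they rule out a letter of length one against kk and identify two letters of length
    one. *)
Lemma encode_inj (k : nat) : 0 < k -> injective (@encode k).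
Proof.
move=> k0; elim=> [|l s IH] [|l' t] // e.
- by have := seq_le_refl (encode (l' :: t)); rewrite -{1}e => /(seq_le_encode_nil k0).
- by have := seq_le_refl (encode (l :: s)); rewrite {2}e => /(seq_le_encode_nil k0).
have le1 : seq_le (encode (l :: s)) (encode (l' :: t)) by rewrite e seq_le_refl.
have le2 : seq_le (encode (l' :: t)) (encode (l :: s)) by rewrite e seq_le_refl.
case: l l' e le1 le2 => [i|] [j|] e; rewrite ?seq_le_encode_none_some //.
- rewrite !seq_le_encode_some => /andP[ij _] /andP[ji _].
  have eij : i = j.
    case/orP: ij => /eqP // i0; case/orP: ji => /eqP // j0.
    by apply: val_inj; rewrite /= i0 j0.
  move: e; rewrite eij !encode_some => /eqP; rewrite eqseq_cat // eqxx /=.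
  by move=> /eqP/IH ->.
- move=> _ _; move: e; rewrite !encode_none => /eqP.
  by rewrite !eqseq_cat // !eqxx /= => /eqP/IH ->.
Qed.

(** * Raising one bit of a code as a step on letters *)

(** The upward direction of an edge, read on strings of letters. The letter 0 is a variable [z] with
    an equation because ['I_k] has a zero only when k > 0. *)
Inductive raise (k : nat) : seq (letter k) -> seq (letter k) -> Prop :=
| raise_letter (z i : 'I_k) s of z = 0 :> nat & 0 < i :
    raise (Some z :: s) (Some i :: s)
| raise_pair (z : 'I_k) s of z = 0 :> nat : raise [:: Some z, Some z & s] (None :: s)
| raise_cons l s t of raise s t : raise (l :: s) (l :: t).

Lemma raise_hamming (k : nat) (s t : seq (letter k)) :
  raise s t -> seq_hamming (encode s) (encode t) = 1.
Proof.
elim=> {s t} [z i s z0 i0|z s z0|l s t _ IH].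
- have [zk ik] := (ltnW (ltn_ord z), ltnW (ltn_ord i)).
  rewrite !encode_some seq_hamming_cat ?size_block // seq_hammingxx.
  by rewrite seq_hamming_block ?seq_le_block // z0 ?eqxx // eq_sym -lt0n i0.
- have [zk k0] := (ltnW (ltn_ord z), leq_ltn_trans (leq0n z) (ltn_ord z)).
  rewrite !encode_some encode_none seq_hamming_cat ?size_block // z0.
  by rewrite seq_hammingxx seq_hamming_block ?seq_le_block // eq_sym -lt0n k0.
- by rewrite /encode /= seq_hamming_cat // seq_hammingxx IH.
Qed.

Lemma raise_le (k : nat) (s t : seq (letter k)) :
  raise s t -> seq_le (encode s) (encode t).
Proof.
elim=> {s t} [z i s z0 i0|z s z0|[i|] s t _ IH].
- by rewrite seq_le_encode_some z0 seq_le_refl.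
- by rewrite seq_le_encode_some_none z0 seq_le_refl.
- by rewrite seq_le_encode_some eqxx orbT.
- by rewrite seq_le_encode_none.
Qed.

(** The distance 1 is the sum over the first blocks and the rest. Either the first blocks agree and
    the step lies further right, or they use up the distance and injectivity of [encode] makes the
    remainders equal. *)
Lemma hamming_raise (k : nat) (s t : seq (letter k)) : 0 < k ->
  seq_le (encode s) (encode t) -> seq_hamming (encode s) (encode t) = 1 ->
  raise s t.
Proof.
move=> k0; elim: s t => [|l s IH] [|l' t] //.
- by move/(seq_le_encode_nil k0).
- by move/(seq_le_encode_nil k0).
case: l l' => [i|] [j|].
- have [ik jk] := (ltnW (ltn_ord i), ltnW (ltn_ord j)).
  rewrite seq_le_encode_some => /andP[ij le_st].
  rewrite !encode_some seq_hamming_cat ?size_block //.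
  rewrite seq_hamming_block ?seq_le_block //.
  have [eij|nij] := eqVneq (val i) (val j) => /=.
    by rewrite (val_inj eij) => /(IH _ le_st); apply: raise_cons.
  case=> /seq_hamming_eq0 est.
  have -> : s = t by apply: encode_inj => //; apply: est; case/seq_leP: le_st.
  have i0 : i = 0 :> nat.
    by case/orP: ij => [/eqP|/eqP ij] //; rewrite ij eqxx in nij.
  by apply: raise_letter => //; rewrite lt0n -i0 eq_sym.
- have ik := ltn_ord i; have ik' := ltnW ik.
  rewrite seq_le_encode_some_none => /andP[/eqP i0 le_st].
  rewrite encode_some encode_none seq_hamming_cat ?size_block // i0.
  (* In the second summand 0 is turned back into [i], so that A_0 followed by [encode t] is
     recognised as the code of [Some i :: t]. *)
  rewrite seq_hamming_block ?seq_le_block // eq_sym -lt0n k0 -[in X in _ + X]i0.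
  case=> /seq_hamming_eq0 est.
  have -> : s = Some i :: t.
    by apply: encode_inj => //; apply: est; case/seq_leP: le_st.
  exact: raise_pair.
- by rewrite seq_le_encode_none_some.
- rewrite seq_le_encode_none => le_st.
  rewrite !encode_none !seq_hamming_cat ?size_block // !seq_hammingxx.
  by move/(IH _ le_st); apply: raise_cons.
Qed.

(** * The adjacency steps on words against the steps on letters *)

(** Explicit contexts [a] and [b] replace positions, which suits induction along the decomposition
    into letters. *)
Definition seq_step1 (k : nat) (u v : seq 'I_k.+1) : Prop :=
  exists a b (c : 'I_k.+1),
    [/\ 0 < c < k, u = a ++ ord0 :: b & v = a ++ c :: b].

Definition seq_step2 (k : nat) (u v : seq 'I_k.+1) : Prop :=
  exists a b, u = a ++ [:: ord0, ord0 & b] /\ v = a ++ [:: ord_max, ord_max & b].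

(** Turns agreement outside a window of length [l] at [j] into a common prefix and suffix; it serves
    single characters with [l] = 1 and pairs with [l] = 2. *)
Lemma tuple_agree_cat (T : eqType) (n j l : nat) (u v : n.-tuple T) : j + l <= n ->
  (forall i : 'I_n, ~~ (j <= i < j + l) -> tnth v i = tnth u i) ->
  u = take j u ++ take l (drop j u) ++ drop (j + l) u :> seq T /\
  v = take j u ++ take l (drop j v) ++ drop (j + l) u :> seq T.
Proof.
move=> jln uv; have split_w (w : n.-tuple T) :
    w = take j w ++ take l (drop j w) ++ drop (j + l) w :> seq T.
  by rewrite (addnC j) -drop_drop !cat_take_drop.
(* The empty tuple is treated apart because [thead u] provides the default value for [nth]. *)
case: n jln u v uv split_w => [|n] jln u v uv split_w.
  by move: (split_w u) (split_w v); rewrite (tuple0 u) (tuple0 v).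
have nthE i : i < n.+1 -> ~~ (j <= i < j + l) ->
    nth (thead u) v i = nth (thead u) u i.
  by move=> iN /(uv (Ordinal iN)); rewrite !(tnth_nth (thead u)).
split=> //; rewrite {1}(split_w v).
congr (_ ++ (_ ++ _)); apply: (@eq_from_nth _ (thead u)).
- by rewrite !size_takel ?size_tuple //; lia.
- move=> i; rewrite size_takel ?size_tuple => [ij|]; last by lia.
  by rewrite !nth_take //; apply: nthE; lia.
- by rewrite !size_drop !size_tuple.
- by move=> i; rewrite size_drop size_tuple => ij; rewrite !nth_drop; apply: nthE; lia.
Qed.

Lemma take1_drop (T : eqType) (n : nat) (u : n.-tuple T) (j : 'I_n) :
  take 1 (drop j u) = [:: tnth u j].
Proof.
by rewrite (drop_nth (tnth u j)) ?size_tuple // -tnth_nth /= take0.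
Qed.

Lemma step1P (n k : nat) (u v : word n k) : step1 u v <-> seq_step1 u v.
Proof.
split.
- case/existsP => j /and3P[/eqP uj vj /forallP uv].
  have jn : j + 1 <= n by rewrite addn1.
  have [|uE vE] := @tuple_agree_cat _ n j 1 u v jn.
    move=> i ij; apply/eqP; apply: (implyP (uv i)); apply: contra ij => /eqP ->.
    by lia.
  exists (take j u), (drop (j + 1) u), (tnth v j).
  by split=> //; [rewrite {1}uE|rewrite {1}vE]; rewrite take1_drop ?uj.
- case=> a [b [c [ck uE vE]]].
  have jn : size a < n by rewrite -(size_tuple u) uE size_cat /=; lia.
  apply/existsP; exists (Ordinal jn); rewrite !(tnth_nth ord0) uE vE /=.
  rewrite !nth_cat ltnn subnn /= ck; apply/forallP => i; apply/implyP.
  rewrite -val_eqE /= !(tnth_nth ord0) uE vE !nth_cat => ij.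
  case: ltngtP ij => // ai _; rewrite -[i - size a]prednK ?subn_gt0 //=.
Qed.

Lemma step2P (n k : nat) (u v : word n k) : step2 u v <-> seq_step2 u v.
Proof.
split.
- case/existsP => j /existsP[j' /and4P[/eqP jj' uj vj /forallP uv]].
  have jn : j + 2 <= n by have := ltn_ord j'; rewrite jj' addn2.
  have [|uE vE] := @tuple_agree_cat _ n j 2 u v jn.
    move=> i ij; apply/eqP; apply: (implyP (uv i)).
    by rewrite -!val_eqE /= jj'; lia.
  have take2 (w : word n k) : take 2 (drop j w) = [:: tnth w j; tnth w j'].
    rewrite (drop_nth ord0) ?size_tuple // -jj' (drop_nth ord0) ?size_tuple //=.
    by rewrite take0 !(tnth_nth ord0).
  exists (take j u), (drop (j + 2) u); rewrite {1}uE {1}vE !take2.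
  by case/andP: uj => /eqP -> /eqP ->; case/andP: vj => /eqP -> /eqP ->.
- case=> a [b [uE vE]].
  have jn : (size a).+1 < n by rewrite -(size_tuple u) uE size_cat /=; lia.
  apply/existsP; exists (Ordinal (ltnW jn)); apply/existsP; exists (Ordinal jn).
  rewrite !(tnth_nth ord0) uE vE /= !nth_cat ltnn subnn ltnNge leqnSn /= subSnn /=.
  rewrite ?eqxx; apply/forallP => i; apply/implyP.
  rewrite -!val_eqE /= !(tnth_nth ord0) uE vE !nth_cat => /andP[ij ij'].
  case: ltngtP ij => // ai _; have -> : i - size a = (i - (size a).+2).+2 by lia.
  by [].
Qed.

Lemma raise_seq_step (k : nat) (s t : seq (letter k)) : raise s t ->
  seq_step1 (expand s) (expand t) \/ seq_step2 (expand s) (expand t).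
Proof.
elim=> {s t} [z i s z0 i0|z s z0|l s t _ IH].
- left; exists [::], (expand s), (widen_ord (leqnSn k) i).
  split; rewrite /= ?i0 ?ltn_ord // /expand /=; congr (_ :: _); exact: val_inj.
- right; exists [::], (expand s); rewrite /expand /=.
  by have -> : widen_ord (leqnSn k) z = ord0 by apply: val_inj.
- rewrite /expand /= -/(expand s) -/(expand t).
  case: IH => [[a [b [c [ck -> ->]]]]|[a [b [-> ->]]]]; rewrite !catA.
    by left; exists (letter_word l ++ a), b, c.
  by right; exists (letter_word l ++ a), b.
Qed.

(** The first character fixes the first letter: a character below k is a letter by itself, and k can
    only open kk. *)
Lemma expand_cons_inv (k : nat) (l : letter k) (t : seq (letter k)) (b : seq 'I_k.+1) :
  expand t = letter_word l ++ b -> exists2 t', t = l :: t' & expand t' = b.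
Proof.
case: t => [|l' t]; first by case: l.
rewrite /expand /= -/(expand t); case: l l' => [i|] [j|] //= [].
- by move=> /val_inj -> <-; exists t.
- by have := ltn_ord i; lia.
- by have := ltn_ord j; lia.
- by move=> <-; exists t.
Qed.

(** The common prefix [a] is consumed one letter of [s] at a time. The changed character is 0, which
    differs from k, so it never lies inside a letter kk of [s]. *)
Lemma seq_step1_raise (k : nat) (s t : seq (letter k)) : 0 < k ->
  seq_step1 (expand s) (expand t) -> raise s t.
Proof.
move=> k0 [a [b [c [ck]]]]; elim: s t a => [|l s IH] t a; first by case: a.
rewrite /expand /= -/(expand s) -/(expand t).
case: l a => [i|] [|x a] /= [].
- move=> i0 <- tE; have [c0 ck'] := andP ck.
  have [|t' -> /(can_inj (@parseK k)) ->] :=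
    @expand_cons_inv k (Some (Ordinal ck')) t (expand s).
    by rewrite tE /=; congr (_ :: _); apply: val_inj.
  exact: raise_letter.
- move=> <- sE /(@expand_cons_inv k (Some i))[t' -> tE].
  exact: raise_cons (IH _ _ sE tE).
- by lia.
(* A prefix of length one would place the changed 0 on the second character of kk. *)
- case: a => [|y a] <- []; first by lia.
  move=> <- sE.
  move=> /(@expand_cons_inv k None)[t' -> tE].
  exact: raise_cons (IH _ _ sE tE).
Qed.

Lemma seq_step2_raise (k : nat) (s t : seq (letter k)) : 0 < k ->
  seq_step2 (expand s) (expand t) -> raise s t.
Proof.
move=> k0 [a [b []]]; elim: s t a => [|l s IH] t a; first by case: a.
rewrite /expand /= -/(expand s) -/(expand t).
case: l a => [i|] [|x a] /= [].
- move=> i0 sE /(@expand_cons_inv k None)[t' -> tE].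
  (* The second 0 opens the remaining expansion, so it is again the letter [i], whose value is 0. *)
  have [|s' -> /esym] := @expand_cons_inv k (Some i) s b.
    by rewrite sE; congr (_ :: _); apply: val_inj.
  by rewrite -tE => /(can_inj (@parseK k)) ->; apply: raise_pair.
- move=> <- sE /(@expand_cons_inv k (Some i))[t' -> tE].
  exact: raise_cons (IH _ _ sE tE).
- by lia.
- case: a => [|y a] <- []; first by lia.
  move=> <- sE.
  move=> /(@expand_cons_inv k None)[t' -> tE].
  exact: raise_cons (IH _ _ sE tE).
Qed.

Lemma munarini_stepP (n k : nat) (u v : word n k) (s t : seq (letter k)) :
  0 < k -> u = expand s :> seq _ -> v = expand t :> seq _ ->
  step1 u v || step2 u v <-> raise s t.
Proof.
move=> k0 uE vE; split=> [/orP[/step1P|/step2P]|/raise_seq_step].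
- by rewrite uE vE; apply: seq_step1_raise.
- by rewrite uE vE; apply: seq_step2_raise.
- by rewrite -uE -vE => -[/step1P->|/step2P->]; rewrite ?orbT.
Qed.

(** * The map [Psi] on vertices and edges *)

Lemma Psi_expand (n k : nat) (u : word n k) (s : seq (letter k)) :
  u = expand s :> seq _ -> Psi u = encode s :> seq bool.
Proof.
by move=> uE; rewrite PsiE ?uE ?parseK //; apply/pell_stringsP; exists s.
Qed.

Lemma Psi_inj (n k : nat) : 0 < k -> {in pell_strings n k &, injective (@Psi n k)}.
Proof.
move=> k0 u v /pell_stringsP[s uE] /pell_stringsP[t vE] /(congr1 (@tval _ _)).
rewrite (Psi_expand uE) (Psi_expand vE) => /(encode_inj k0) st.
by apply: val_inj; rewrite /= uE vE st.
Qed.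

(** A code is k times as long as its word, so cancelling k > 0 shows that the decoded word has
    length n. *)
Lemma encode_Psi (n k : nat) (w : bits (k * n)) (s : seq (letter k)) : 0 < k ->
  w = encode s :> seq bool ->
  exists u : word n k, u = expand s :> seq _ /\ Psi u = w.
Proof.
move=> k0 wE; have sn : size (expand s) == n.
  by rewrite -(eqn_pmul2l k0) -size_encode -wE size_tuple.
exists (Tuple sn); split=> //; apply: val_inj.
by apply: etrans (esym wE); apply: Psi_expand.
Qed.

Lemma Psi_image (n k : nat) : 0 < k -> @Psi n k @: pell_strings n k = Fstar n k.
Proof.
move=> k0; apply/setP => w; apply/imsetP/idP => [[u uF ->]|/FstarP].
  exact: Psi_Fstar.
case=> // s /(encode_Psi k0)[u [uE <-]]; exists u => //.
by apply/pell_stringsP; exists s.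
Qed.

(** A Munarini step upwards is a [raise], that is, a comparable pair of codes at distance 1. Since
    strings at distance 1 are comparable one way or the other, symmetrising the step removes the
    order condition. *)
Lemma Psi_adj (n k : nat) : 0 < k ->
  {in pell_strings n k &, forall u v,
    adj (munarini n k) u v = (hamming (Psi u) (Psi v) == 1)}.
Proof.
move=> k0 u v uF vF; rewrite adj_rel_graph uF vF /=.
have [s uE] := (pell_stringsP u).1 uF; have [t vE] := (pell_stringsP v).1 vF.
have raiseE (x y : word n k) p q : x = expand p :> seq _ -> y = expand q :> seq _ ->
    step1 x y || step2 x y = bits_le (Psi x) (Psi y) && (hamming (Psi x) (Psi y) == 1).
  move=> xE yE; rewrite bits_le_seq hamming_seq (Psi_expand xE) (Psi_expand yE).
  apply/idP/andP => [/(munarini_stepP k0 xE yE) pq|[le_pq /eqP h1]].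
    by rewrite raise_hamming // raise_le.
  exact/(munarini_stepP k0 xE yE)/hamming_raise.
rewrite (raiseE _ _ _ _ uE vE) (raiseE _ _ _ _ vE uE) [hamming (Psi v) _]hammingC.
rewrite -andb_orl; have [h1|] := eqVneq (hamming (Psi u) (Psi v)) 1; last first.
  by rewrite !andbF.
rewrite (hamming1_le h1) !andbT; apply/eqP => uv.
by have := hamming0 (Psi u) (Psi v); rewrite h1 uv eqxx.
Qed.

Lemma Fstar_down (n k : nat) : 0 < k -> down (Fstar n k) = Fstar n k.
Proof.
move=> k0; apply/setP => w; rewrite [LHS]inE; apply/existsP/idP => [[x /andP[]]|wF].
  case/FstarP => // s xE; rewrite bits_le_seq xE => /(encode_downward k0).
  by move=> tE; apply/FstarP.
by exists w; rewrite wF bits_le_refl.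
Qed.

(** * Zero-free strings as generators *)

Lemma zerofree_expand (k : nat) (s : seq (letter k)) : 0 < k ->
  (ord0 \notin expand s) = zerofree s.
Proof.
move=> k0; elim: s => //= l s <-; rewrite /expand /= -/(expand s) mem_cat negb_or.
congr (_ && _); case: l => [i|]; rewrite ?inE -?val_eqE /=.
  by rewrite eq_sym lt0n.
by rewrite (ltn_eqF k0).
Qed.

(** For k > 1 the letter 1 exists, and replacing every letter 0 by 1 only raises bits. *)
Lemma zerofree_cover (k : nat) (s : seq (letter k)) : 1 < k ->
  exists t : seq (letter k), zerofree t /\ seq_le (encode s) (encode t).
Proof.
move=> k1; elim: s => [|l s [t [t0 st]]]; first by exists [::].
case: l => [i|]; last by exists (None :: t); rewrite seq_le_encode_none.
have [i0|i0] := posnP i.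
  by exists (Some (Ordinal k1) :: t); rewrite seq_le_encode_some i0.
by exists (Some i :: t); rewrite seq_le_encode_some eqxx orbT /= i0.
Qed.

Lemma zerofree_pellP (n k : nat) (u : word n k) : 0 < k ->
  u \in zerofree_pell_strings n k <->
  exists2 s : seq (letter k), u = expand s :> seq _ & zerofree s.
Proof.
move=> k0; have memE s : u = expand s :> seq _ -> (ord0 \notin u) = zerofree s.
  by move=> uE; rewrite -zerofree_expand // -uE.
rewrite inE; split=> [/andP[/pell_stringsP[s uE] u0]|[s uE s0]].
  by exists s; rewrite // -memE.
by rewrite (memE s) // s0 andbT; apply/pell_stringsP; exists s.
Qed.

(** Every code lies below a zero-free one of the same length, which is the image of some word; the
    other inclusion is downward closure of [Fstar]. *)
Lemma Fstar_zerofree (n k : nat) : 1 < k ->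
  Fstar n k = down [set Psi u | u in zerofree_pell_strings n k].
Proof.
move=> k1; have k0 := ltnW k1; apply/eqP; rewrite eqEsubset; apply/andP; split.
  apply/subsetP => w /FstarP[] // s wE; have [t [t0 le_st]] := zerofree_cover s k1.
  have st : size (encode t) == k * n.
    by have [<- _] := seq_leP _ _ le_st; rewrite -wE size_tuple.
  have [u [uE uw]] := @encode_Psi n k (Tuple st) t k0 erefl.
  rewrite inE; apply/existsP; exists (Psi u).
  rewrite bits_le_seq uw /= wE le_st andbT -uw; apply: imset_f.
  by apply/zerofree_pellP => //; exists t.
rewrite -(Fstar_down n k0); apply/subsetP => w; rewrite !inE.
case/existsP => x /andP[/imsetP[u] + ->]; rewrite inE => /andP[uF _] wu.
by apply/existsP; exists (Psi u); rewrite Psi_Fstar.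
Qed.

Theorem theorem3p3 (n k : nat) (hn : 1 <= n) (hk : 1 <= k) :
  is_daisy_cube (munarini n k) /\
  (2 <= k ->
   let X : {set bits (k * n)} := [set Psi u | u in zerofree_pell_strings n k] in
   [/\ proper_embedding (munarini n k) (@Psi n k),
       Gamma_star n k = daisy_cube X
     & maximal_vertices (daisy_cube X) = X]).
Proof.
have PsiP : proper_embedding (munarini n k) (@Psi n k).
  (* The whole set [Fstar] is taken as generator, which works for k = 1 too; there [X] is empty when
     n is odd. *)
  apply: (@proper_embedding_adj _ _ _ _ (Fstar n k)).
  - exact: Psi_inj.
  - by rewrite Fstar_down // Psi_image.
  - exact: Psi_adj.
split=> [|k1 X]; first by exists (k * n), (@Psi n k).
split=> //; first by rewrite /Gamma_star Fstar_zerofree.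
(* Maximal vertices are the maximal elements of [X], so it remains to show that no member of [X]
   lies strictly below another. *)
rewrite maximal_vertices_daisy; apply/setP => x; rewrite inE andb_idr //.
case/imsetP => u /(zerofree_pellP u hk)[s uE s0] ->; apply/forallP => y.
apply/implyP => /imsetP[v /(zerofree_pellP v hk)[t vE _] ->]; apply/implyP.
rewrite bits_le_seq (Psi_expand uE) (Psi_expand vE).
move=> /(zerofree_maximal hk s0) st; apply/eqP.
by congr Psi; apply: val_inj; rewrite /= uE vE st.
Qed.
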